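(* Let $n\ge 1$ be a natural number and let $u$ be an ultrafilter on $\omega$. The following statements are equivalent: (1) There is no monotone sequential contour $C$ of rank $n$ with $C\subset u$. (2) $u\in\bigcup_{i=1}^{n}\mathcal{P}_i$. (3) For every family of functions $f_1,\dots,f_{n-1}:\omega\to\omega$ there exists $U\in u$ such that either (a) $f_1\circ\cdots\circ f_{n-1}$ restricted to $U$ is constant, or (b) there exists $i\in\{1,\dots,n-1\}$ such that $f_i$ restricted to the set $f_{i+1}\circ\cdots\circ f_{n-1}(U)$ is finite-to-one (for $i=n-1$ the empty composition is the identity, so this set is $U$). (4) For every function $f:\omega\to\omega$ there exists $U\in u$ such that either (a) $f^{n-1}$ restricted to $U$ is constant, or (b) there exists $i\in\{1,\dots,n-1\}$ such that $f$ restricted to $f^{i-1}(U)$ is finite-to-one (here $f^0$ is the identity and $f^k$ is the $k$-fold composition).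
   Context: For a function $f:X\to Y$ and a filter $p$ on $X$, $f(p)=\{B\subseteq Y: f^{-1}(B)\in p\}$. A filter on a subset $A\subseteq\omega$ is identified with the filter on $\omega$ it generates. A cascade is a tree $V$ without infinite branches and with a least element $\emptyset_V$; $v^+$ denotes the set of immediate successors of $v\in V$ and $v^\uparrow$ the subcascade consisting of $v$ and all elements above it. $V$ is sequential if $v^+$ is countably infinite for every non-maximal $v$. Ranks: $r(v)=0$ if $v$ is maximal, otherwise $r(v)$ is the least ordinal greater than $r(w)$ for all $w\in v^+$; $r(V)=r(\emptyset_V)$. A sequential cascade is monotone if every $v^+$ ($v$ non-maximal) can be enumerated as $(v_k)_{k<\omega}$ with $(r(v_k))_k$ non-decreasing. The contour $\int V$ of a sequential cascade $V$ is the filter on $\max V$ defined recursively: for maximal $v$, $\int v^\uparrow$ is the principal ultrafilter at $v$; otherwise $\int v^\uparrow=\{A\subseteq \max v^\uparrow: A\cap\max v_k^\uparrow\in\int v_k^\uparrow$ for all but finitely many $k\}$, and $\int V=\int\emptyset_V^\uparrow$ (equivalently, the trace on $\max V$ of the neighbourhood filter of $\emptyset_V$ in the finest topology on $V$ in which the cofinite filter on each $v^+$ converges to $v$). A monotone sequential contour of rank $\alpha$ is a filter $\int V$ (regarded as a filter on $\omega$) for a monotone sequential cascade $V$ of rank $\alpha$ with $\max V\subseteq\omega$; this rank is well defined. For $1\le\alpha<\omega_1$, $\mathcal{P}_\alpha$ is the class of ultrafilters $u$ on $\omega$ that contain no monotone sequential contour of rank $\alpha$ but, for each $1\le\beta<\alpha$,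 contain some monotone sequential contour of rank $\beta$. *)

(* Defs.v *)
From HB Require Import structures.
From mathcomp Require Import all_boot all_order.
From mathcomp Require Import all_classical.

Set Implicit Arguments.
Unset Strict Implicit.
Unset Printing Implicit Defensive.

Import Order.TTheory.
Local Open Scope classical_set_scope.

Section Cascades.
Context {d : Order.disp_t} {V : bPOrderType d}.
Implicit Types (v w : V) (A B C : set V).

Definition is_tree : Prop :=
  forall v A, A `<=` [set w | (w < v)%O] -> A !=set0 ->
    exists2 m, A m & forall a, A a -> (m <= a)%O.

Definition is_chain B : Prop := total_on B (fun v w => (v <= w)%O).

Definition is_branch B : Prop :=
  is_chain B /\ forall C, is_chain C -> B `<=` C -> C = B.

(* The least element is the bottom \bot of V. *)
Definition is_cascade : Prop :=
  is_tree /\ forall B, is_branch B -> finite_set B.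

Definition is_maximal v : Prop := forall w, (v <= w)%O -> w = v.

Definition succs v : set V :=
  [set w | (v < w)%O /\ ~ exists x, (v < x)%O /\ (x < w)%O].

Definition max_above v : set V := [set w | (v <= w)%O /\ is_maximal w].

Definition is_sequential : Prop :=
  forall v, ~ is_maximal v -> (succs v #= [set: nat])%card.

(* Every r(w) is at most r(\bot), so all the ordinals that occur as ranks in a
   cascade of rank n < omega are natural numbers.  The second clause gives
   r v = 0 when v is maximal. *)
Definition is_rank (r : V -> nat) : Prop :=
  forall v, (forall w, succs v w -> (r w < r v)%N) /\
    forall k, (forall w, succs v w -> (r w < k)%N) -> (r v <= k)%N.

Definition is_monotone (r : V -> nat) : Prop :=
  forall v, ~ is_maximal v -> exists e : nat -> V,
    set_bij [set: nat] (succs v) e /\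
    forall i j, (i <= j)%N -> (r (e i) <= r (e j))%N.

(* [contour v] is the contour of the subcascade of the elements above v.  In a
   cascade, recursion along the tree is well founded, so these clauses have a
   unique solution; F is the finite set of exceptional successors. *)
Inductive contour (v : V) (A : set V) : Prop :=
| contour_max : is_maximal v -> A `<=` max_above v -> A v -> contour v A
| contour_succs (F : set V) : ~ is_maximal v -> A `<=` max_above v ->
    finite_set F ->
    (forall w, succs v w -> ~ F w -> contour w (A `&` max_above w)) ->
    contour v A.

End Cascades.

Arguments is_cascade {d} V.
Arguments is_sequential {d} V.
Arguments contour {d V}.

(* The injection lab identifies max V with a subset of omega, and filter_from
   produces the filter on omega generated by the contour. *)
Definition monotone_sequential_contour (n : nat) (C : set_system nat) : Prop :=
  exists (d : Order.disp_t) (V : bPOrderType d) (r : V -> nat)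
         (lab : V -> nat),
    [/\ is_cascade V /\ is_sequential V,
        is_rank r /\ r \bot%O = n,
        is_monotone r,
        set_inj (max_above (\bot%O : V)) lab
      & C = filter_from (contour (\bot%O : V)) (fun A => lab @` A)].

(* The class P_n, meant for n >= 1. *)
Definition Pclass (n : nat) : set (set_system nat) :=
  [set u | [/\ UltraFilter u,
      ~ (exists2 C, monotone_sequential_contour n C & C `<=` u)
    & forall k, (1 <= k < n)%N ->
        exists2 C, monotone_sequential_contour k C & C `<=` u]].

Definition constant_on (f : nat -> nat) (U : set nat) : Prop :=
  exists c, forall x, U x -> f x = c.

Definition finite_to_one_on (f : nat -> nat) (U : set nat) : Prop :=
  forall y, finite_set [set x | U x /\ f x = y].

(* f_i o f_{i+1} o ... o f_{m-1}, the identity when i >= m *)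
Definition comps (f : nat -> nat -> nat) (i m : nat) : nat -> nat :=
  \big[(fun g h : nat -> nat => g \o h)/id]_(i <= k < m) f k.

(* Main.v *)
(** Proof idea, for the two implications with content.

(2) => (3).  Suppose the maps f_1, ..., f_{n-1} violate (3) and let m <= n.
Call x a child of f_j(x), with the last used map replaced by the constant 0, and
keep only the numbers having infinitely many kept children.  As f_j is finite-to-one
on no set of the image ultrafilter at its level, the kept numbers form a set of
that ultrafilter.  They form a cascade of rank m all of whose leaves have depth m.
If A belongs to its contour, then at each level the set of nodes v with
A in the contour of v belongs to the image ultrafilter: this passes from
a level to the next one, again because f_j is not finite-to-one.

(4) => (1).  In a monotone sequential cascade of rank n, all but finitely many
successors of a node of rank k + 1 have rank k.  So one can restrict to leaves
below which every rank 0, ..., n occurs.  Coding the inner nodes by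
numbers outside some set of u, a single map f can send the code of each node to
the code of its parent.  If f^(n-1) were constant, or f finite-to-one on f^(i-1)(U),
for some U in u, then the contour would contain the complement of U. *)

Require Import Defs.
From HB Require Import structures.
From mathcomp Require Import all_boot all_order.
From mathcomp Require Import all_classical zify.

Local Open Scope classical_set_scope.

Import Order.TTheory.

(** * Cascades with a rank function *)

Section RankedTree.
Context {d : Order.disp_t} {V : bPOrderType d} (r : V -> nat).
Hypotheses (treeV : @is_tree d V) (rankV : is_rank r) (monoV : is_monotone r).
Implicit Types (v w x : V) (A U : set V).

(** The tree condition at [w] gives the open interval between [v] and [w], if nonempty, a least
    element. *)
Lemma succ_le v w : (v < w)%O -> exists2 z, succs v z & (z <= w)%O.
Proof.
move=> vw.
have [[z0 z0P]|none] := pselect ([set z | (v < z)%O /\ (z < w)%O] !=set0).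
  have [m [vm mw] mmin] := treeV w [set z | (v < z)%O /\ (z < w)%O]
    (fun z zP => zP.2) (ex_intro _ z0 z0P).
  exists m; last exact: ltW.
  split=> // -[x [vx xm]].
  by have := lt_le_trans xm (mmin x (conj vx (lt_trans xm mw))); rewrite ltxx.
by exists w => //; split=> // -[x xP]; apply: none; exists x.
Qed.

Lemma rank_lt v w : (v < w)%O -> (r w < r v)%N.
Proof.
have [k] := ubnP (r v); elim: k v => // k IH v; rewrite ltnS => vk vw.
have [z vz] := succ_le v w vw; rewrite le_eqVlt => /orP[/eqP <-|zw].
  exact: (rankV v).1.
have zv := (rankV v).1 z vz.
by apply: (ltn_trans _ zv); apply: IH => //; exact: leq_trans zv vk.
Qed.

Lemma rank_le v w : (v <= w)%O -> (r w <= r v)%N.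
Proof. by rewrite le_eqVlt => /orP[/eqP ->//|/rank_lt/ltnW]. Qed.

Lemma maximal_rank v : is_maximal v <-> r v = 0%N.
Proof.
split=> [vmax|rv0 w].
  apply/eqP; rewrite -leqn0; apply: (rankV v).2 => w [vw _].
  by have := vmax w (ltW vw) => wv; rewrite wv ltxx in vw.
by rewrite le_eqVlt => /orP[/eqP ->//|/rank_lt]; rewrite rv0.
Qed.

Lemma nonmaximal_rank {v k} : r v = k.+1 -> ~ is_maximal v.
Proof. by move=> rv /maximal_rank; rewrite rv. Qed.

Lemma below_le x v w :
  (v <= x)%O -> (w <= x)%O -> (v <= w)%O \/ (w <= v)%O.
Proof.
rewrite le_eqVlt => /orP[/eqP ->|vx]; first by right.
rewrite le_eqVlt => /orP[/eqP ->|wx]; first by left; exact: ltW.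
have [||m [->|->] mP] := treeV x [set v; w].
- by move=> _ [->|->].
- by exists v; left.
- by left; apply: mP; right.
- by right; apply: mP; left.
Qed.

(** The elements below [x] form a chain along which the rank strictly decreases. *)
Lemma below_rank_inj x v w :
  (v <= x)%O -> (w <= x)%O -> r v = r w -> v = w.
Proof.
move=> vx wx rvw.
by have [] := below_le x v w vx wx; rewrite le_eqVlt => /orP[/eqP//|/rank_lt];
  rewrite rvw ltnn.
Qed.

Lemma below_rank_le x v w :
  (v <= x)%O -> (w <= x)%O -> (r v <= r w)%N -> (w <= v)%O.
Proof.
move=> vx wx rvw; have [|//] := below_le x v w vx wx.
rewrite le_eqVlt => /orP[/eqP ->//|/rank_lt].
by rewrite ltnNge rvw.
Qed.

(** Some successor has rank [k], since otherwise [r v] would be at most [k]; in a monotone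
    enumeration every later successor then has rank [k] too. *)
Lemma finite_succs_low v k : r v = k.+1 ->
  finite_set [set w | succs v w /\ r w <> k].
Proof.
move=> rv; have [e [[ein _ esurj] emono]] := monoV v (nonmaximal_rank rv).
have rlt w : succs v w -> (r w <= k)%N.
  by move=> vw; rewrite -ltnS -rv; exact: (rankV v).1.
have [i ri] : exists i, r (e i) = k.
  apply: contrapT => none.
  have : (r v <= k)%N; last by rewrite rv ltnn.
  apply: (rankV v).2 => w vw; rewrite ltn_neqAle rlt// andbT.
  by apply/eqP => rw; have [i _ ei] := esurj w vw; apply: none; exists i; rewrite ei.
apply: (@sub_finite_set _ _ (e @` `I_i)); last exact/finite_image/finite_II.
move=> w [vw rw]; have [j _ ej] := esurj w vw; exists j => //=.
rewrite ltnNge; apply/negP => /emono; rewrite ej ri => kw.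
by apply: rw; apply/eqP; rewrite eqn_leq kw rlt.
Qed.

Lemma max_aboveI v w A : (v <= w)%O ->
  A `&` max_above v `&` max_above w = A `&` max_above w.
Proof.
move=> vw; apply/seteqP; split=> x; first by move=> [[? _] ?].
by move=> [Ax [wx xm]]; do !split=> //; exact: le_trans vw wx.
Qed.

(** Successors whose rank drops by more than one go into the exceptional set, so an induction on
    rank meets level [k] exactly. *)
Lemma contour_level A k :
  (forall v, r v = k -> contour v (A `&` max_above v)) ->
  forall v, (k <= r v)%N -> contour v (A `&` max_above v).
Proof.
move=> base v; move rv : (r v) => m; elim: m v rv => [|m IH] v rv.
  by rewrite leqn0 => /eqP k0; apply: base; rewrite k0.
rewrite leq_eqVlt => /orP[/eqP km|]; first by apply: base; rewrite km.
rewrite ltnS => km.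
apply: (@contour_succs _ _ v _ [set w | succs v w /\ r w <> m]) => //.
- exact: nonmaximal_rank rv.
- exact: finite_succs_low.
- by move=> w vw nF; rewrite max_aboveI ?(ltW vw.1)//; apply: IH => //;
    apply: contrapT => rw; apply: nF.
Qed.

Lemma contour_max_above v : contour v (max_above v).
Proof.
have := @contour_level setT 0 _ v (leq0n _); rewrite setTI; apply => w w0.
have wmax := (maximal_rank w).2 w0.
by rewrite setTI; apply: contour_max.
Qed.

(** The path from the root to such a leaf skips no rank, so the number of steps from the leaf to a
    node on this path is the rank of the node. *)
Definition full_leaf x := is_maximal x /\
  forall j, (j <= r \bot%O)%N -> exists2 w, (w <= x)%O & r w = j.

Lemma contour_full_leaf : contour (\bot%O : V) full_leaf.
Proof.
suff H v : contour v [set x | max_above v x /\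
    forall j, (j <= r v)%N -> exists2 w, (w <= x)%O & r w = j].
  rewrite (_ : full_leaf = [set x | max_above \bot%O x /\
    forall j, (j <= r \bot%O)%N -> exists2 w, (w <= x)%O & r w = j]) //.
  apply/seteqP; split=> x; last by move=> [[_ xm] xr]; split.
  by move=> [xm xr]; do !split=> //; exact: le0x.
move rv : (r v) => m; elim: m v rv => [|m IH] v rv.
  have vmax := (maximal_rank v).2 rv.
  apply: contour_max => //; first by move=> ? [].
  split; first by split.
  by move=> j; rewrite leqn0 => /eqP ->; exists v.
apply: (@contour_succs _ _ v _ [set w | succs v w /\ r w <> m]) => //.
- exact: nonmaximal_rank rv.
- by move=> ? [].
- exact: finite_succs_low.
- move=> w vw nF.
  have rw : r w = m by apply: contrapT => rw; apply: nF.
  rewrite (_ : _ `&` _ = [set x | max_above w x /\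
    forall j, (j <= m)%N -> exists2 z, (z <= x)%O & r z = j]); first exact: IH.
  apply/seteqP; split=> x; last first.
    move=> [[wx xm] jP]; have vx := le_trans (ltW vw.1) wx.
    split; [split|] => // j; rewrite leq_eqVlt => /orP[/eqP ->|]; last exact: jP.
    by exists v.
  by move=> [[_ jP] wx]; split=> // j jm; apply: jP; exact: leqW.
Qed.

(** At a node of rank [k.+1] the successors of rank [k] that lie below a point of [U] are finitely
    many, hence exceptional; every other successor of rank [k] has its whole set of leaves outside
    [U]. *)
Lemma contour_setD U k : (k < r \bot%O)%N ->
  (forall v, r v = k.+1 ->
    finite_set [set w | [/\ succs v w, r w = k & exists2 x, U x & (w <= x)%O]]) ->
  contour (\bot%O : V) (~` U `&` max_above \bot%O).
Proof.
move=> kr finU; apply: contour_level kr => v rv.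
apply: (@contour_succs _ _ _ _
  ([set w | succs v w /\ r w <> k] `|`
   [set w | [/\ succs v w, r w = k & exists2 x, U x & (w <= x)%O]])) => //.
- exact: nonmaximal_rank rv.
- by rewrite finite_setU; split; [exact: finite_succs_low | exact: finU].
- move=> w vw nF; rewrite max_aboveI ?(ltW vw.1)//.
  rewrite (_ : ~` U `&` _ = max_above w); first exact: contour_max_above.
  apply/seteqP; split=> x; first by case.
  move=> [wx xm]; split=> // Ux; apply: nF.
  by have [rw|rw] := pselect (r w = k); [right; split=> //; exists x | left].
Qed.

End RankedTree.

(** * From a contour to a self-map *)

Section Ultrafilters.
Context {u : set_system nat} (hu : UltraFilter u).

Lemma ultra_disjoint (A B : set nat) :
  u A -> u B -> (forall x, A x -> B x -> False) -> False.
Proof.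
move=> uA uB AB; apply: (@filter_not_empty _ u _).
by apply: filterS (filterI uA uB) => x [/AB].
Qed.

Lemma ultra_setC (A : set nat) : ~ u A -> u (~` A).
Proof. by move=> nuA; have [] := in_ultra_setVsetC A hu. Qed.

(** One candidate takes even values, the other odd ones; an ultrafilter cannot contain both
    ranges. *)
Lemma ultra_sparse_inj : exists phi : nat * nat -> nat,
  injective phi /\ u (~` range phi).
Proof.
pose phi (b : bool) (p : nat * nat) := (b + (pickle p).*2)%N.
have phi_inj b : injective (phi b).
  by move=> p q /addnI /double_inj /(pcan_inj pickleK).
have [u0|/ultra_setC u0] := pselect (u (range (phi false))); last first.
  by exists (phi false).
exists (phi true); split=> //; apply: filterS u0 => _ [p _ <-] [q _ /(congr1 odd)].
by rewrite !oddD !odd_double.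
Qed.

End Ultrafilters.

(** * Coding the nodes of a cascade by numbers *)

Section CodingMap.
Context {d : Order.disp_t} {V : bPOrderType d} (r lab : V -> nat).
Hypotheses (treeV : @is_tree d V) (rankV : is_rank r).
Hypothesis lab_inj : set_inj (max_above (\bot%O : V)) lab.
Context (phi : nat * nat -> nat) (phi_inj : injective phi).
Implicit Types (v w x : V).

Definition leaf_above v : V := xget \bot%O [set x | full_leaf r x /\ (v <= x)%O].

(* An inner node is determined by its rank and any leaf above it. *)
Definition code v : nat :=
  if r v == 0%N then lab v else phi (r v, lab (leaf_above v)).

Definition coding_leaf x := full_leaf r x /\ ~ range phi (lab x).

Definition coding_node v := exists2 x, coding_leaf x & (v <= x)%O.

Definition decode (y : nat) : V := xget \bot%O [set v | coding_node v /\ code v = y].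

Definition parent v : V := xget \bot%O [set w | (w <= v)%O /\ r w = (r v).+1].

Definition coding_map (y : nat) : nat := code (parent (decode y)).

Lemma leaf_lab_inj x y : is_maximal x -> is_maximal y -> lab x = lab y -> x = y.
Proof. by move=> xm ym; apply: lab_inj; rewrite inE; split=> //; exact: le0x. Qed.

Lemma leaf_aboveP v : coding_node v ->
  full_leaf r (leaf_above v) /\ (v <= leaf_above v)%O.
Proof.
move=> [x [xf _] vx].
by apply: (@xgetPex _ _ [set x | full_leaf r x /\ (v <= x)%O]); exists x.
Qed.

(** Labels of coding leaves avoid the range of [phi], so leaves and inner nodes cannot clash. Inner
    nodes with equal codes share their rank and a leaf above them. *)
Lemma code_inj v w : coding_node v -> coding_node w -> code v = code w -> v = w.
Proof.
move=> Nv Nw; rewrite /code.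
have leaf z : r z = 0%N -> is_maximal z by move/(maximal_rank r treeV rankV).
have sparse z : coding_node z -> r z = 0%N -> ~ range phi (lab z).
  by move=> [x [_ xphi] zx] /leaf /(_ x zx) <-.
case: eqP => rv; case: eqP => rw.
- by apply: leaf_lab_inj; exact: leaf.
- by move=> vE; case: (sparse v Nv rv); rewrite vE; exists (r w, lab (leaf_above w)).
- by move=> wE; case: (sparse w Nw rw); rewrite -wE; exists (r v, lab (leaf_above v)).
- move=> /phi_inj[rvw]; have [[vm _] vl] := leaf_aboveP v Nv.
  have [[wm _] wl] := leaf_aboveP w Nw => /(leaf_lab_inj _ _ vm wm) vwl.
  by apply: (below_rank_inj r treeV rankV (leaf_above v)) => //; rewrite vwl.
Qed.

Lemma codeK v : coding_node v -> decode (code v) = v.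
Proof.
move=> Nv; apply: xget_unique => // w [Nw]; exact: code_inj.
Qed.

Lemma parentE v w : (w <= v)%O -> r w = (r v).+1 -> parent v = w.
Proof.
move=> wv rw; apply: xget_unique => // z [zv rz].
by apply: (below_rank_inj r treeV rankV v) => //; rewrite rz rw.
Qed.

Lemma coding_map_code v w : coding_node v -> (w <= v)%O -> r w = (r v).+1 ->
  coding_map (code v) = code w.
Proof. by move=> Nv wv rw; rewrite /coding_map codeK// (parentE v w). Qed.

Lemma iter_coding_map x w : coding_leaf x -> (w <= x)%O ->
  iter (r w) coding_map (lab x) = code w.
Proof.
move=> Wx; move rw : (r w) => k; elim: k w rw => [|k IH] w rw wx.
  by rewrite /code rw eqxx (proj2 (maximal_rank r treeV rankV w) rw x wx).
have [z zx rz] : exists2 z, (z <= x)%O & r z = k.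
  apply: Wx.1.2; apply: ltnW; rewrite -rw.
  exact: (rank_le r treeV rankV _ _ (le0x w)).
rewrite iterS (IH z)//; apply: coding_map_code.
- by exists x.
- by apply: (below_rank_le r treeV rankV x) => //; rewrite rz rw.
- by rewrite rz.
Qed.

End CodingMap.

(** The coding map depends only on the cascade and on [phi], so one [f] refutes both alternatives
    for every [U] in [u]. *)
Lemma self_map_of_contour (n : nat) (u : set_system nat) (C : set_system nat) :
  (1 <= n)%N -> UltraFilter u -> monotone_sequential_contour n C -> C `<=` u ->
  exists f : nat -> nat, forall U, u U ->
    ~ constant_on (iter n.-1 f) U /\
    forall i, (1 <= i < n)%N -> ~ finite_to_one_on f (iter i.-1 f @` U).
Proof.
move=> n0 hu [d [V [r [lab [[[treeV _] _] [rankV rbot] monoV lab_inj ->]]]]] Cu.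
have [phi [phi_inj phiu]] := ultra_sparse_inj hu.
have contour_u (A : set V) : contour (\bot%O : V) A -> u (lab @` A).
  by move=> cA; apply: Cu; exists A.
have leaf_u : u (lab @` coding_leaf r lab phi).
  apply: filterS (filterI (contour_u _ (contour_full_leaf r treeV rankV monoV)) phiu).
  by move=> _ [[x xf <-] xphi]; exists x.
exists (coding_map r lab phi) => U uU.
pose U' := [set x | coding_leaf r lab phi x /\ U (lab x)].
(* For each [k] some node of rank [k.+1] has infinitely many successors of rank [k] below leaves of
   [U']; otherwise the complement of [U'] would be in the contour, hence its labels in [u]. *)
have nU' k : (k < n)%N -> ~ (forall v, r v = k.+1 ->
    finite_set [set w | [/\ succs v w, r w = k & exists2 x, U' x & (w <= x)%O]]).
  rewrite -rbot => kn /(contour_setD r treeV rankV monoV _ _ kn)/contour_u uA.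
  apply: (ultra_disjoint hu _ _ (filterI leaf_u uU) uA).
  move=> _ [[x Wx <-] Ux] [y [nU'y [_ ym]]].
  move=> /(leaf_lab_inj lab lab_inj _ _ ym Wx.1.1) yx.
  by apply: nU'y; rewrite yx.
have iterE x w k : U' x -> (w <= x)%O -> r w = k ->
    iter k (coding_map r lab phi) (lab x) = code r lab phi w.
  move=> [Wx _] wx <-; exact: (iter_coding_map r lab treeV rankV lab_inj phi phi_inj).
have decodeE x w : U' x -> (w <= x)%O ->
    decode r lab phi (code r lab phi w) = w.
  move=> [Wx _] wx; apply: (codeK r lab treeV rankV lab_inj phi phi_inj).
  by exists x.
split=> [[c cU]|i /andP[i0 iltn] fto].
  (* A node of rank [n.-1] below a leaf of [U'] has code [c], so there is at most one. *)
  apply: (nU' n.-1); first by rewrite prednK.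
  move=> v _; apply: (sub_finite_set _ (finite_set1 (decode r lab phi c))).
  move=> w [_ rw [x U'x wx]] /=.
  by rewrite -(cU _ U'x.2) (iterE x w)// (decodeE x).
apply: (nU' i.-1); first by rewrite prednK// ltnW.
move=> v; rewrite prednK// => rv.
(* The codes of these successors all lie in the fibre of the coding map over the code of [v]. *)
apply: sub_finite_set (finite_image (decode r lab phi) (fto (code r lab phi v))).
move=> w [vw rw [x U'x wx]]; exists (code r lab phi w); last exact: decodeE wx.
split; first by exists (lab x); [exact: U'x.2 | exact: iterE].
apply: (coding_map_code r lab treeV rankV lab_inj phi phi_inj).
- by exists x => //; exact: U'x.1.
- exact: ltW vw.1.
- by rewrite rv rw prednK.
Qed.

(** * From maps to a contour *)

Section LevelTree.
Context (phi : nat -> nat -> nat) (m : nat).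

Fixpoint climb (t k z : nat) : nat :=
  if k is k'.+1 then phi (t + k') (climb t k' z) else z.

(** The condition is hereditary: only branching preimages count, so pruning leaves each kept inner
    number infinitely many children. *)
Fixpoint branching (t : nat) : set nat :=
  if t is t'.+1 then
    [set y | infinite_set [set z | branching t' z /\ phi t' z = y]]
  else setT.

(** The last clause stops short of rank [m], so the root is a node for any [phi]; that it branches
    is assumed separately as [root_branching]. *)
Definition alive (p : nat * nat) : Prop :=
  [/\ (p.1 <= m)%N, climb p.1 (m - p.1) p.2 = 0%N &
      forall k, (p.1 + k < m)%N -> branching (p.1 + k) (climb p.1 k p.2)].

(* The pair (t, y) stands for the number y at rank t, and [climb t k] leads k ranks
   up, towards the root (m, 0). *)
Definition level_node := {p : nat * nat | `[< alive p >]}.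

HB.instance Definition _ := Choice.on level_node.

Definition mk_node p (ap : alive p) : level_node := exist _ p (asboolT ap).

Definition level (v : level_node) : nat := (val v).1.
Definition label (v : level_node) : nat := (val v).2.

Implicit Types (v w : level_node).

Lemma climbD t k l z : climb t (k + l) z = climb (t + k) l (climb t k z).
Proof. by elim: l => [|l IH]; rewrite ?addn0// addnS /= IH addnA. Qed.

Lemma climbSr t k z : climb t k.+1 z = climb t.+1 k (phi t z).
Proof. by rewrite -add1n climbD /= addn0 addn1. Qed.

Lemma alive_node v : alive (level v, label v).
Proof. by case: v => -[t y] ?; exact/asboolP. Qed.

Lemma level_le v : (level v <= m)%N.
Proof. by have [] := alive_node v. Qed.

Lemma node_ext v w : level v = level w -> label v = label w -> v = w.
Proof.
move=> lvw yvw; apply/val_inj.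
by rewrite (surjective_pairing (val v)) (surjective_pairing (val w)) -/(level v)
  -/(label v) lvw yvw.
Qed.

Definition level_node_le v w : bool :=
  (level w <= level v)%N && (climb (level w) (level v - level w) (label w) == label v).

Lemma level_node_le_refl : reflexive level_node_le.
Proof. by move=> v; rewrite /level_node_le subnn leqnn /=. Qed.

Lemma level_node_le_anti : antisymmetric level_node_le.
Proof.
move=> v w /andP[/andP[wv /eqP vE] /andP[vw _]].
have lvw : level v = level w by apply/eqP; rewrite eqn_leq vw wv.
by apply: node_ext => //; rewrite -vE lvw subnn.
Qed.

Lemma level_node_le_trans : transitive level_node_le.
Proof.
move=> w v x /andP[wv /eqP vE] /andP[xw /eqP wE].
rewrite /level_node_le (leq_trans xw wv) -vE -wE /=.
by rewrite -{1}(subnKC xw) -climbD addnC addnBA// subnK.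
Qed.

HB.instance Definition _ := Order.Le_isPOrder.Build Order.default_display level_node
  level_node_le_refl level_node_le_anti level_node_le_trans.

Lemma alive_root : alive (m, 0%N).
Proof. by split=> [//||k] /=; rewrite ?subnn// ltnNge leq_addr. Qed.

Definition level_root : level_node := mk_node _ alive_root.

Lemma level_root_le v : (level_root <= v)%O.
Proof. by apply/andP; split; [exact: level_le | have [_ /= ->] := alive_node v]. Qed.

HB.instance Definition _ :=
  Order.hasBottom.Build Order.default_display level_node level_root_le.

HB.instance Definition _ := isPointed.Build level_node level_root.

Lemma node_leP v w : (v <= w)%O <->
  (level w <= level v)%N /\ climb (level w) (level v - level w) (label w) = label v.
Proof. by split=> [/andP[? /eqP]|[? ?]]; [|apply/andP; split=> //; exact/eqP]. Qed.

Lemma node_lt_level v w : (v < w)%O -> (level w < level v)%N.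
Proof.
rewrite lt_neqAle => /andP[/eqP vw /node_leP[wv vE]].
rewrite ltn_neqAle wv andbT; apply/eqP => lwv; apply: vw; apply: node_ext => //.
by rewrite -vE lwv subnn.
Qed.

Lemma node_child v t z : level v = t.+1 -> branching t z -> phi t z = label v ->
  exists w, [/\ level w = t, label w = z & (v <= w)%O].
Proof.
move=> lv Dz zv; have [/= tm climb0 Dv] := alive_node v.
have aw : alive (t, z).
  split=> /=; first by apply: ltnW; rewrite -lv.
    by rewrite -[(m - t)%N](@prednK) ?subn_gt0 -?lv// climbSr zv -subnS -lv.
  case=> [|k]; first by rewrite addn0.
  by rewrite addnS -addSn -lv climbSr zv lv -{1}lv => /Dv; rewrite lv.
exists (mk_node _ aw); split=> //.
by apply/node_leP; rewrite /level /label /= -/(level v) lv subSnn /= addn0.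
Qed.

Lemma node_parent w : (level w < m)%N ->
  exists v, [/\ level v = (level w).+1, label v = phi (level w) (label w) & (v <= w)%O].
Proof.
move=> wm; have [/= _ climb0 Dw] := alive_node w.
have av : alive ((level w).+1, phi (level w) (label w)).
  split=> //=; first by rewrite -climbSr -subSn.
  by move=> k; rewrite addSnnS => /Dw; rewrite addnS climbSr.
exists (mk_node _ av); split=> //.
by apply/node_leP; rewrite /level /label /= -/(level w) subSnn /= addn0.
Qed.

Lemma node_below_le v w x :
  (v <= x)%O -> (w <= x)%O -> (level w <= level v)%N -> (v <= w)%O.
Proof.
move=> /node_leP[xv vE] /node_leP[xw wE] wv; apply/node_leP; split=> //.
by rewrite -vE -wE -{1}(subnKC xw) -climbD addnC addnBA// subnK.
Qed.

(** The parent of [w] lies between [v] and [w], so it equals [v] when [w] is an immediate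
    successor. *)
Lemma succs_node v w : succs v w <->
  level v = (level w).+1 /\ phi (level w) (label w) = label v.
Proof.
split=> [[vw none]|[lv vE]].
  have lwv := node_lt_level _ _ vw.
  have [a [la aE aw]] := node_parent w (leq_trans lwv (level_le v)).
  suff -> : v = a by rewrite la aE.
  have va : (v <= a)%O by apply: node_below_le aw _; [exact: ltW | rewrite la].
  apply: contrapT => /eqP nva; apply: none; exists a; rewrite !lt_neqAle nva va aw.
  by split=> //; rewrite andbT; apply/eqP => aw'; move: la; rewrite aw' => /n_Sn.
have vw : (v <= w)%O by apply/node_leP; rewrite lv leqnSn subSnn /= addn0.
split.
  by rewrite lt_neqAle vw andbT; apply/eqP => vw'; move: lv; rewrite vw' => /n_Sn.
move=> [x [/node_lt_level + /node_lt_level]].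
by rewrite lv ltnS leqNgt => /negP.
Qed.

Lemma level_tree_is_tree : @is_tree _ level_node.
Proof.
move=> v A Av [a0 Aa0].
(* The least element of [A] is the one of largest level, since the nodes below [v] are ordered by
   level. *)
pose P k := `[< exists2 a, A a & (m - level a)%N = k >].
have exP : exists k, P k by exists (m - level a0)%N; apply/asboolP; exists a0.
case: (ex_minnP exP) => k /asboolP[a Aa <-] kmin; exists a => // b Ab.
apply: (node_below_le a b v (ltW (Av a Aa)) (ltW (Av b Ab))).
have := kmin (m - level b)%N (asboolT (ex_intro2 _ _ b Ab erefl)).
by have := level_le a; have := level_le b; lia.
Qed.

Lemma level_branch_finite (B : set level_node) : is_branch B -> finite_set B.
Proof.
(* A chain has at most one node on each of the levels [0] to [m]. *)
move=> [chainB _].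
apply: (@sub_finite_set _ _
  ((fun k => xget level_root [set v | B v /\ level v = k]) @` `I_m.+1)); last first.
  exact/finite_image/finite_II.
move=> v Bv; exists (level v); first by rewrite /= ltnS level_le.
apply: xget_unique => // w [Bw wv].
by have [] := chainB v w Bv Bw => /node_leP[_]; rewrite wv subnn /= => /node_ext->.
Qed.

Hypothesis root_branching : branching m 0.

Lemma node_branching v : branching (level v) (label v).
Proof.
have [vm climb0 Dv] := alive_node v.
move: vm; rewrite leq_eqVlt => /orP[/eqP /= vm|vm].
  by move: climb0; rewrite /= vm subnn /= => ->.
by have := Dv 0%N; rewrite addn0; exact.
Qed.

Lemma infinite_succs v t : level v = t.+1 -> infinite_set (succs v).
Proof.
move=> lv; have := node_branching v; rewrite lv /= => infD finS; apply: infD.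
apply: sub_finite_set (finite_image label finS) => z [Dz zv].
have [w [lw wz vw]] := node_child v t z lv Dz zv.
by exists w => //; apply/succs_node; rewrite lv lw wz.
Qed.

Lemma maximal_level v : is_maximal v <-> level v = 0%N.
Proof.
split=> [vmax|lv w].
  case lv : (level v) => [//|t].
  have /infinite_setN0[w [vw _]] := infinite_succs v t lv.
  by move: (vw); rewrite (vmax w (ltW vw)) ltxx.
by rewrite le_eqVlt => /orP[/eqP//|/node_lt_level]; rewrite lv.
Qed.

Lemma nonmaximal_level v : ~ is_maximal v -> exists t, level v = t.+1.
Proof.
move=> nvm; case lv : (level v) => [|t]; last by exists t.
by case: nvm; exact/maximal_level.
Qed.

Lemma level_sequential : is_sequential level_node.
Proof.
move=> v /nonmaximal_level[t lv]; rewrite card_eq_le; apply/andP; split.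
  exact: countableP.
by apply/infiniteP; exact: infinite_succs lv.
Qed.

Lemma level_is_rank : is_rank level.
Proof.
move=> v; split=> [w [vw _]|k kP]; first exact: node_lt_level.
case lv : (level v) => [//|t].
have /infinite_setN0[w vw] := infinite_succs v t lv.
have := kP w vw; have [] := (succs_node v w).1 vw.
by rewrite lv => -[->].
Qed.

(** All successors of a node have the same level, so any enumeration is non-decreasing. *)
Lemma level_is_monotone : is_monotone level.
Proof.
move=> v nvm; have := level_sequential v nvm; rewrite card_eq_sym => /card_set_bijP[e eP].
exists e; split=> // i j _; have [ein _ _] := eP.
have [/eqP + _] := (succs_node _ _).1 (ein i I).
have [/eqP + _] := (succs_node _ _).1 (ein j I).
by move=> /eqP -> /eqP [->].
Qed.

Lemma label_inj : set_inj (max_above (\bot%O : level_node)) label.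
Proof.
move=> v w; rewrite !inE => -[_ /maximal_level lv] [_ /maximal_level lw].
by apply: node_ext; rewrite lv lw.
Qed.

Lemma level_tree_contour :
  monotone_sequential_contour m
    (filter_from (contour (\bot%O : level_node)) (fun A => label @` A)).
Proof.
exists _, level_node, level, label; split=> //.
- split; last exact: level_sequential.
  by split; [exact: level_tree_is_tree | exact: level_branch_finite].
- by split; [exact: level_is_rank |].
- exact: level_is_monotone.
- exact: label_inj.
Qed.

End LevelTree.

(** * The contour of the level tree inside an ultrafilter *)

Section LevelTreeInUltrafilter.
Context (phi : nat -> nat -> nat) (m : nat) {u : set_system nat} (hu : UltraFilter u).
Hypothesis climb_root : forall x, climb phi 0 m x = 0%N.
Hypothesis not_fto : forall t U, (t < m)%N -> u U ->
  ~ finite_to_one_on (phi t) (climb phi 0 t @` U).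

(** Otherwise intersect the preimage of [A] with that of the complement of [B]: on the image of this
    set [phi t] has empty fibres over [B] and finite ones elsewhere, against [not_fto]. *)
Lemma ultra_climb t (A B : set nat) : (t < m)%N ->
  u (climb phi 0 t @^-1` A) ->
  (forall y, ~ B y -> finite_set [set z | A z /\ phi t z = y]) ->
  u (climb phi 0 t.+1 @^-1` B).
Proof.
move=> tm uA finA; apply: contrapT => /(ultra_setC hu) unB.
apply: (not_fto t _ tm (filterI uA unB)) => y.
have [By|nBy] := pselect (B y).
  rewrite (_ : [set _ | _] = set0)//; apply/seteqP; split=> // z [[x [_ nB] xz] zy].
  by apply: nB; rewrite /= xz zy.
by apply: sub_finite_set (finA y nBy) => z [[x [Ax _] <-] ?].
Qed.

Lemma ultra_branching t : (t <= m)%N -> u (climb phi 0 t @^-1` branching phi t).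
Proof.
elim: t => [|t IH] tm; first exact: filterT.
by apply: ultra_climb (IH (ltnW tm)) _ => // y /contrapT.
Qed.

Lemma branching_root : branching phi m 0.
Proof.
by have [x] := filter_ex (ultra_branching m (leqnn m)); rewrite /= climb_root.
Qed.

Lemma level_contour_sub :
  filter_from (contour (\bot%O : level_node phi m)) (fun A => label _ _ @` A) `<=` u.
Proof.
move=> B [A cA AB]; apply: filterS AB _.
(* [S] is carried from the root, at level [m], down to the leaves, where it consists of labels of
   elements of [A]. *)
pose S t := [set y | exists v : level_node phi m, [/\ level _ _ v = t,
  label _ _ v = y & contour v (A `&` max_above v)]].
have uS k : (k <= m)%N -> u (climb phi 0 (m - k) @^-1` S (m - k)%N).
  elim: k => [|k IH] km.
    rewrite subn0; apply: filterS filterT => x _; exists \bot%O; split=> //.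
    rewrite (_ : A `&` _ = A)//; apply/setIidPl.
    by case: cA.
  have tm : (m - k.+1 < m)%N by lia.
  have tS : (m - k.+1).+1 = (m - k)%N by lia.
  (* If [S] failed at this level, climbing from its complement would make it fail one level up. *)
  apply: contrapT => /(ultra_setC hu) unS.
  have uD := ultra_branching _ (ltnW tm).
  suff /(ultra_disjoint hu _ _ (IH (ltnW km))) :
      u (climb phi 0 (m - k) @^-1` ~` S (m - k)%N).
    by apply=> x Sx; exact.
  rewrite -tS; apply: ultra_climb _ (~` S (m - k.+1)%N `&` branching phi (m - k.+1)) _
    tm (filterI unS uD) _.
  rewrite tS.
  move=> y /contrapT [v [lv vy]].
  case=> [/(maximal_level _ _ branching_root)|F _ _ finF cF]; first by rewrite lv; lia.
  (* A branching preimage of [y] outside [S] labels a child of [v] that must be exceptional. *)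
  apply: sub_finite_set (finite_image (label _ _) finF) => z [[nSz Dz] zy].
  have [w [lw wz vw]] :=
    node_child _ _ v _ z (etrans lv (esym tS)) Dz (etrans zy (esym vy)).
  exists w => //; apply: contrapT => nFw; apply: nSz; exists w; split=> //.
  have := cF w; rewrite max_aboveI//; apply=> //.
  by apply/succs_node; rewrite lv lw tS wz vy zy.
have := uS m (leqnn m); rewrite subnn; apply: filterS => x [v [lv vx]].
have vmax := (maximal_level _ _ branching_root v).2 lv.
by case=> [_ _ [Av _]|F /(_ vmax)//]; exists v.
Qed.

End LevelTreeInUltrafilter.

(** * Finite images and compositions of maps *)

Lemma ultra_finite_image {u : set_system nat} (g : nat -> nat) (U : set nat) :
  UltraFilter u -> u U -> finite_set (g @` U) ->
  exists2 U', u U' & constant_on g U'.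
Proof.
move=> hu uU /finite_seqP[s gU].
have : u [set x | g x \in s].
  apply: filterS uU => x Ux.
  by have : (g @` U) (g x) by [exists x]; rewrite gU.
elim: s {gU} => [|y s IH] us.
  by exfalso; apply: (@filter_not_empty _ u _); apply: filterS us.
have [uy|/(ultra_setC hu) uy] := pselect (u [set x | g x = y]).
  by exists [set x | g x = y] => //; exists y.
apply: IH; apply: filterS (filterI us uy) => x /= [].
by rewrite inE => /orP[/eqP|].
Qed.

Lemma comps_ge f i n : (n <= i)%N -> comps f i n = id.
Proof. by move=> ni; rewrite /comps big_geq. Qed.

Lemma comps_ltn f i n : (i < n)%N -> comps f i n = f i \o comps f i.+1 n.
Proof. by move=> ni; rewrite /comps big_ltn. Qed.

Lemma comps_cat f i j n : (i <= j <= n)%N ->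
  comps f i n = comps f i j \o comps f j n.
Proof.
move=> /andP[ij jn]; move jik : (j - i)%N => k; elim: k i ij jik => [|k IH] i ij jik.
  by rewrite (_ : i = j) ?(comps_ge f j j)//; lia.
have ij' : (i < j)%N by lia.
rewrite (comps_ltn f i n (leq_trans ij' jn)) (comps_ltn f i j ij').
by rewrite (IH i.+1 ij' _)//; lia.
Qed.

Lemma comps_const (f : nat -> nat) i n : comps (fun=> f) i n = iter (n - i) f.
Proof.
move nik : (n - i)%N => k; elim: k i nik => [|k IH] i nik.
  by rewrite comps_ge//; lia.
by rewrite comps_ltn ?IH//; lia.
Qed.

Lemma contour_of_maps (n m : nat) (f : nat -> nat -> nat) (u : set_system nat) :
  (1 <= m <= n)%N -> UltraFilter u ->
  (forall U, u U -> ~ constant_on (comps f 1 n) U) ->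
  (forall U i, u U -> (1 <= i < n)%N ->
    ~ finite_to_one_on (f i) (comps f i.+1 n @` U)) ->
  exists2 C, monotone_sequential_contour m C & C `<=` u.
Proof.
move=> /andP[m0 mn] hu nconst nfto.
(* The constant map at the top sends everything to the root; not being
   finite-to-one there means that no image of a set of u is finite. *)
pose phi t := if t.+1 == m then fun=> 0%N else f (n - t.+1)%N.
(* Level [t] carries the composition of the [t] innermost maps. *)
have climbE t x : (t < m)%N -> climb phi 0 t x = comps f (n - t) n x.
  elim: t => [|t IH] tm /=; first by rewrite subn0 comps_ge.
  rewrite add0n {1}/phi ltn_eqF// comps_ltn; last lia.
  by rewrite IH 1?ltnW//= subnSK//; lia.
have climb_root x : climb phi 0 m x = 0%N.
  by rewrite -(prednK m0) /= add0n /phi prednK// eqxx.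
have H t U : (t < m)%N -> u U -> ~ finite_to_one_on (phi t) (climb phi 0 t @` U).
  move=> tm uU.
  rewrite (_ : climb phi 0 t = comps f (n - t) n); last first.
    by apply/funext => x; exact: climbE.
  rewrite /phi; case: eqP => [tE|tE].
    move=> /(_ 0%N) fin.
    have [|U' uU' [c cU']] := ultra_finite_image (comps f (n - t) n) U hu uU.
      by apply: sub_finite_set fin => z.
    (* The remaining outer maps preserve constancy. *)
    apply: (nconst U' uU'); exists (comps f 1 (n - t) c) => x U'x.
    by rewrite (@comps_cat f 1 (n - t) n) /= ?cU'//; lia.
  have -> : (n - t)%N = (n - t.+1).+1 by lia.
  by apply: nfto => //; lia.
exists (filter_from (contour (\bot%O : level_node phi m)) (fun A => label _ _ @` A)).
  by apply: level_tree_contour; exact: (branching_root phi m hu climb_root H).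
exact: (level_contour_sub phi m hu climb_root H).
Qed.

Theorem theorem3p1 (n : nat) (hn : (1 <= n)%N)
    (u : set_system nat) (hu : UltraFilter u) :
  [<-> ~ (exists2 C, monotone_sequential_contour n C & C `<=` u);
       (\bigcup_(i in [set i | (1 <= i <= n)%N]) Pclass i) u;
       forall f : nat -> nat -> nat, exists2 U, u U &
         constant_on (comps f 1 n) U \/
         exists2 i, (1 <= i < n)%N &
           finite_to_one_on (f i) (comps f i.+1 n @` U);
       forall f : nat -> nat, exists2 U, u U &
         constant_on (iter n.-1 f) U \/
         exists2 i, (1 <= i < n)%N &
           finite_to_one_on f (iter i.-1 f @` U)].
Proof.
tfae.
- move=> no_contour.
  (* The class containing [u] is indexed by the least rank at which no contour lies in [u]. *)
  pose P k := `[< (1 <= k)%N /\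
    ~ exists2 C, monotone_sequential_contour k C & C `<=` u >].
  have exP : exists k, P k by exists n; apply/asboolP.
  case: (ex_minnP exP) => k /asboolP[k1 noC] kmin.
  exists k; first by rewrite /= k1 kmin//; exact/asboolP.
  split=> // j /andP[j1 jk]; apply: contrapT => noCj.
  by have := kmin j (asboolT (conj j1 noCj)); rewrite leqNgt jk.
- move=> [i ilen [_ noC _]] f; apply: contrapT => noU; apply: noC.
  apply: (contour_of_maps n i f u ilen hu) => [U uU fU|U j uU jn fU]; apply: noU.
  + by exists U => //; left.
  + by exists U => //; right; exists j.
- move=> maps f; have [U uU fU] := maps (fun=> f); exists U => //.
  move: fU; rewrite comps_const subn1 => -[?|[i iltn]]; first by left.
  (* In (3) the innermost map has the largest index, while (4) counts from the innermost
     application; this reverses [i] to [n - i]. *)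
  rewrite comps_const => fi; right; exists (n - i)%N; first by lia.
  by rewrite -subnS.
- move=> maps [C monoC Cu].
  have [f nf] := self_map_of_contour n u C hn hu monoC Cu.
  have [U uU] := maps f; have [nconst nfto] := nf U uU.
  by move=> [//|[i /nfto]].
Qed.
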